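(* Let $S\in Sp(2g,\mathbb{Z})$ be a symplectic involution, i.e. $S^{T}JS=J$ and $S^2=\mathrm{Id}$. Then $S$ is symplectically equivalent to a matrix of the form $\begin{pmatrix}a&0\\0&a\end{pmatrix}$, where $a$ is the $g\times g$ block diagonal matrix $$a=\begin{pmatrix}1_{p}&&&&\\ & -1_{m}&&&\\ &&Q_0&&\\ &&&\ddots&\\ &&&&Q_0\end{pmatrix},\qquad Q_0=\begin{pmatrix}0&1\\1&0\end{pmatrix},$$ for some non-negative integers $p,m$ and some number $t\ge 0$ of $2\times 2$ blocks $Q_0$, so that $g=p+m+2t$.
   Context: $1_n$ denotes the $n\times n$ identity matrix. $J=\begin{pmatrix}0&1_g\\-1_g&0\end{pmatrix}$ is the canonical symplectic pairing and $Sp(2g,\mathbb{Z})=\{\gamma\in GL(2g,\mathbb{Z})\mid \gamma^{T}J\gamma=J\}$. Two matrices $S,S'\in Sp(2g,\mathbb{Z})$ are symplectically equivalent if $S'=TST^{-1}$ for some $T\in Sp(2g,\mathbb{Z})$. Any of $p$, $m$, $t$ may be zero, in which case the corresponding blocks are absent. *)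

(* Defs.v *)
From mathcomp Require Import all_boot all_order all_algebra.

Set Implicit Arguments.
Unset Strict Implicit.
Unset Printing Implicit Defensive.

Import GRing.Theory.
Local Open Scope ring_scope.

(* 'M_(g + g) rather than 'M_(2 * g), so that g x g blocks can be written
   with block_mx. *)
Definition Jmx (g : nat) : 'M[int]_(g + g) :=
  block_mx 0 1%:M (- 1%:M) 0.

(* Over int, membership in unitmx means that the inverse is integral. *)
Definition Sp (g : nat) (A : 'M[int]_(g + g)) : Prop :=
  A \in unitmx /\ A^T *m Jmx g *m A = Jmx g.

Definition symplectically_equivalent (g : nat) (S S' : 'M[int]_(g + g)) : Prop :=
  exists T : 'M[int]_(g + g), Sp T /\ S' = T *m S *m invmx T.

Definition Q0 : 'M[int]_2 := block_mx (0 : 'M_1) 1%:M 1%:M (0 : 'M_1).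

Lemma sum2E (t : nat) : (\sum_(i < t) 2 = 2 * t)%N.
Proof. by rewrite sum_nat_const card_ord mulnC. Qed.

(* \mxdiag has dimension \sum_(i < t) 2, equal to 2 * t but not convertible
   to it for a variable t; castmx only changes the type. *)
Definition Q0_blocks (t : nat) : 'M[int]_(2 * t) :=
  castmx (sum2E t, sum2E t) (\mxdiag_(i < t) Q0).

Definition amx (p m t : nat) : 'M[int]_(p + m + 2 * t) :=
  block_mx (block_mx (1%:M : 'M_p) 0 0 (- 1%:M : 'M_m)) 0
           0 (Q0_blocks t).

(* Main.v *)
Require Import Defs.
From mathcomp Require Import all_boot all_order all_algebra.

Local Open Scope ring_scope.

Set Implicit Arguments.
Unset Strict Implicit.
Unset Printing Implicit Defensive.

Import GRing.Theory Num.Theory.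

(** Write w for the symplectic form on the lattice Z^n, n = 2g.  The proof stays
    inside Z^n and builds a symplectic basis on which S acts by the matrix a,
    starting from the empty family and adding one small cell at a time.

    A partial basis is an adapted frame: two n x k matrices E and F whose
    columns span isotropic sublattices dual to each other under w, with
    S E = E a and S F = F a.  As the Gram matrix of a frame is unimodular, Z^n
    splits orthogonally as the span of the frame plus the image R of an
    integral projector, its residual, and S preserves both summands.  The
    extension step (involution_cell_exists) finds, whenever R <> 0, a cell
    inside the image of R, that is, a frame on which S acts by 1, -1 or Q0.
    Two observations make this work without ever choosing a basis of the
    complement.

    - If some x in the image of R has x + S x outside 2 Z^n, then x can be
      corrected by S-invariant and S-anti-invariant vectors until both x + S x
      and x - S x are primitive.  Then x and S x span a primitive sublattice
      of rank 2, so some y in the image of R satisfies w(x, y) = 1 and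
      w(S x, y) = 0.  The pairs (x, S x) and (y, S y) form a cell of type Q0,
      because w(x, S x) = w(y, S y) = 0 always holds: w(., S .) is again an
      alternating form (swap_cell_exists).
    - Otherwise (1 + S) R / 2 is an integral projector, so the image of R is
      the orthogonal sum of its S-invariant and S-anti-invariant parts, both
      unimodular.  A primitive vector x of a nonzero part together with a
      dual vector y in the same part is a cell of type 1 or -1
      (sign_cell_exists).

    A frame with k columns satisfies 2k <= n, so the process ends with R = 0,
    and then the frame is a symplectic basis.  The blocks appear in an arbitrary
    order; they are sorted at each step by a permutation of the indices, applied
    to E and F simultaneously.  Such a permutation matrix Q is orthogonal, so
    that E Q and F Q are still dual bases (adapted_frame_similar). *)

(** * Similarity by integral orthogonal matrices *)

(** The sizes k and l are allowed to be different terms, although they are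
    always equal (orthogonally_similar_size): casts and the reassociation of
    block sums then become instances of the relation.  Orthogonality of Q is
    what allows Q to act on the two halves of a symplectic basis alike. *)
Definition orthogonally_similar k l (A : 'M[int]_k) (B : 'M[int]_l) : Prop :=
  exists Q : 'M[int]_(k, l),
    [/\ Q^T *m Q = 1%:M, Q *m Q^T = 1%:M & A *m Q = Q *m B].

Definition direct_sum k l (A : 'M[int]_k) (B : 'M[int]_l) : 'M[int]_(k + l) :=
  block_mx A 0 0 B.

Lemma orthogonally_similar_refl k (A : 'M[int]_k) : orthogonally_similar A A.
Proof. by exists 1%:M; rewrite trmx1 !mulmx1 mul1mx. Qed.

Lemma orthogonally_similar_trans k l h
    (B : 'M[int]_l) (A : 'M[int]_k) (C : 'M[int]_h) :
  orthogonally_similar A B -> orthogonally_similar B C ->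
  orthogonally_similar A C.
Proof.
move=> [Q [Q1 Q2 Q3]] [P [P1 P2 P3]]; exists (Q *m P); rewrite trmx_mul; split.
- by rewrite mulmxA -(mulmxA P^T) Q1 mulmx1.
- by rewrite mulmxA -(mulmxA Q) P2 mulmx1.
- by rewrite mulmxA Q3 -mulmxA P3 mulmxA.
Qed.

Lemma orthogonally_similar_sym k l (A : 'M[int]_k) (B : 'M[int]_l) :
  orthogonally_similar A B -> orthogonally_similar B A.
Proof.
move=> [Q [Q1 Q2 Q3]]; exists Q^T; rewrite trmxK; split=> //.
by rewrite -[LHS]mul1mx -Q1 -!mulmxA (mulmxA Q) -Q3 -(mulmxA A) Q2 mulmx1.
Qed.

Lemma orthogonally_similar_size k l (A : 'M[int]_k) (B : 'M[int]_l) :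
  orthogonally_similar A B -> k = l.
Proof.
move=> [Q [QTQ QQT _]]; apply/eqP.
by rewrite eqn_leq (mulmx1_min QTQ) (mulmx1_min QQT).
Qed.

Lemma orthogonally_similar_sum k k' l l' (A : 'M[int]_k) (A' : 'M[int]_k')
    (B : 'M[int]_l) (B' : 'M[int]_l') :
  orthogonally_similar A A' -> orthogonally_similar B B' ->
  orthogonally_similar (direct_sum A B) (direct_sum A' B').
Proof.
move=> [Q [Q1 Q2 Q3]] [P [P1 P2 P3]]; exists (block_mx Q 0 0 P).
rewrite /direct_sum tr_block_mx !trmx0 !mulmx_block.
rewrite !mulmx0 !mul0mx !addr0 !add0r Q1 Q2 Q3 P1 P2 P3.
by rewrite -!scalar_mx_block.
Qed.

Lemma orthogonally_similar_sumC k l (A : 'M[int]_k) (B : 'M[int]_l) :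
  orthogonally_similar (direct_sum A B) (direct_sum B A).
Proof.
exists (block_mx 0 1%:M 1%:M 0); rewrite /direct_sum tr_block_mx !trmx0 !trmx1.
rewrite !mulmx_block !mulmx0 !mul0mx !mulmx1 !mul1mx !addr0 !add0r.
by rewrite -!scalar_mx_block.
Qed.

(** Two separate proofs of k = l occur because mxdiag_recl produces a cast whose
    row and column proofs need not be the same term. *)
Lemma orthogonally_similar_cast k l (e e' : k = l) (A : 'M[int]_k) :
  orthogonally_similar A (castmx (e, e') A).
Proof.
rewrite (eq_irrelevance e' e); case: l / e e' => _.
by rewrite castmx_id; exact: orthogonally_similar_refl.
Qed.

Lemma orthogonally_similar_sumA k l h (A : 'M[int]_k) (B : 'M[int]_l)
    (C : 'M[int]_h) :
  orthogonally_similar (direct_sum (direct_sum A B) C)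
                       (direct_sum A (direct_sum B C)).
Proof.
have := @block_mxA _ k l h k l h A 0 0 0 B 0 0 0 C.
rewrite /= !row_mx0 !col_mx0 -!/(direct_sum _ _) => ->.
exact: orthogonally_similar_cast.
Qed.

Lemma orthogonally_similar_sumAC k l h (A : 'M[int]_k) (B : 'M[int]_l)
    (C : 'M[int]_h) :
  orthogonally_similar (direct_sum (direct_sum A B) C)
                       (direct_sum (direct_sum A C) B).
Proof.
apply: orthogonally_similar_trans (orthogonally_similar_sumA A B C) _.
apply: orthogonally_similar_trans
  (orthogonally_similar_sym (orthogonally_similar_sumA A C B)).
exact: orthogonally_similar_sum (orthogonally_similar_refl A)
         (orthogonally_similar_sumC B C).
Qed.

(** * Sorting the diagonal blocks *)

Inductive involution_cell : forall l, 'M[int]_l -> Prop :=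
| PlusCell : @involution_cell 1 1%:M
| MinusCell : @involution_cell 1 (- 1%:M)
| SwapCell : @involution_cell 2 Q0.

Lemma Q0_blocksS t :
  orthogonally_similar (direct_sum (Q0_blocks t) Q0) (Q0_blocks t.+1).
Proof.
apply: orthogonally_similar_trans
  (orthogonally_similar_sum
     (orthogonally_similar_sym (orthogonally_similar_cast _ _ _))
     (orthogonally_similar_refl _)) _.
apply: orthogonally_similar_trans (orthogonally_similar_sumC _ _) _.
apply: orthogonally_similar_trans
  (orthogonally_similar_cast (sum2E t.+1) (sum2E t.+1) _).
rewrite mxdiag_recl.
exact: orthogonally_similar_cast.
Qed.

(** A new cell at the end can be moved, by permuting summands, next to the blocks
    of its own type, so that the canonical shape is restored at each step. *)
Lemma amx_sum_cell p m t l (b : 'M[int]_l) :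
  involution_cell b ->
  exists p' m' t',
    orthogonally_similar (direct_sum (amx p m t) b) (amx p' m' t').
Proof.
have amxE p1 m1 t1 : amx p1 m1 t1 =
  direct_sum (direct_sum (1%:M : 'M_p1) (- 1%:M : 'M_m1)) (Q0_blocks t1) by [].
have sum1 k : direct_sum (1%:M : 'M_k) (1%:M : 'M_1) = 1%:M.
  by rewrite /direct_sum -scalar_mx_block.
have sumN1 k : direct_sum (- 1%:M : 'M_k) (- 1%:M : 'M_1) = - 1%:M.
  by rewrite -(sum1 k) /direct_sum opp_block_mx !oppr0.
have refl k (A : 'M_k) := orthogonally_similar_refl A.
case=> {l b}.
- exists (p + 1)%N, m, t; rewrite !amxE -(sum1 p).
  apply: orthogonally_similar_trans (orthogonally_similar_sumAC _ _ _) _.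
  exact: orthogonally_similar_sum
           (orthogonally_similar_sumAC _ _ _) (refl _ _).
- exists p, (m + 1)%N, t; rewrite !amxE.
  apply: orthogonally_similar_trans (orthogonally_similar_sumAC _ _ _) _.
  apply: orthogonally_similar_sum _ (refl _ _).
  apply: orthogonally_similar_trans (orthogonally_similar_sumA _ _ _) _.
  by rewrite sumN1; exact: refl.
- exists p, m, t.+1; rewrite !amxE.
  apply: orthogonally_similar_trans (orthogonally_similar_sumA _ _ _) _.
  exact: orthogonally_similar_sum (refl _ _) (Q0_blocksS t).
Qed.

(** * Adapted frames and their orthogonal complements *)

(** For an involution, preserving w amounts to being self-adjoint for w; the
    self-adjoint form is the one that is used in all computations. *)
Record involutive_isometry n (w S : 'M[int]_n) : Prop := InvolutiveIsometry {
  form_skew : w^T = - w;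
  form_unimodular : w \in unitmx;
  isometry_selfadjoint : S^T *m w = w *m S;
  isometry_involutive : S *m S = 1%:M
}.

Definition adapted_frame n k (w S : 'M[int]_n) (a : 'M[int]_k)
    (E F : 'M[int]_(n, k)) : Prop :=
  [/\ E^T *m w *m E = 0, F^T *m w *m F = 0, E^T *m w *m F = 1%:M,
      S *m E = E *m a & S *m F = F *m a].

(** The orthogonal projector onto the complement of the span of E and F.  The
    projector onto the span itself sends v to F w(E, v) - E w(F, v), the
    expansion of v in a symplectic basis, which involves no division. *)
Definition residual n k (w : 'M[int]_n) (E F : 'M[int]_(n, k)) : 'M[int]_n :=
  1%:M - F *m (E^T *m w) + E *m (F^T *m w).

Lemma skew_swap n (w : 'M[int]_n) k l (X : 'M[int]_(n, k)) (Y : 'M[int]_(n, l)) :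
  w^T = - w -> (X^T *m w *m Y)^T = - (Y^T *m w *m X).
Proof. by move=> wT; rewrite !trmx_mul wT trmxK mulNmx mulmxN mulmxA. Qed.

(** A 1 x 1 Gram matrix is its own transpose, and Z has no 2-torsion. *)
Lemma skew_self n (w : 'M[int]_n) (x : 'cV[int]_n) :
  w^T = - w -> x^T *m w *m x = 0.
Proof.
move=> wT; apply/matrixP=> i j; rewrite !ord1 [RHS]mxE.
have /matrixP/(_ 0 0) := skew_swap x x wT; rewrite mxE [RHS]mxE => /eqP.
by rewrite -addr_eq0 -mulr2n mulrn_eq0 => /eqP.
Qed.

Lemma adapted_frame_unimodular n k (w S : 'M[int]_n) (a : 'M[int]_k) E F :
  w^T = - w -> adapted_frame w S a E F -> F^T *m w *m E = - 1%:M.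
Proof.
move=> wT [_ _ EF _ _]; apply: oppr_inj.
by rewrite -(skew_swap E F wT) EF trmx1 opprK.
Qed.

(** The Gram matrix of E and F exhibits the matrix (E F) as left invertible over
    Z, so it cannot have more columns than rows.  This bound makes the
    construction of frames terminate. *)
Lemma adapted_frame_size n k (w S : 'M[int]_n) (a : 'M[int]_k) E F :
  w^T = - w -> adapted_frame w S a E F -> (k + k <= n)%N.
Proof.
move=> wT Efr; have FE := adapted_frame_unimodular wT Efr.
have [EE FF EF _ _] := Efr.
apply: (@mulmx1_min _ _ _ (col_mx (- (F^T *m w)) (E^T *m w)) (row_mx E F)).
by rewrite mul_col_row !mulNmx EE FF EF FE oppr0 opprK -scalar_mx_block.
Qed.

Lemma adapted_frame_similar n k l (w S : 'M[int]_n) (a : 'M[int]_k)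
    (b : 'M[int]_l) E F :
  orthogonally_similar a b -> adapted_frame w S a E F ->
  exists E' F', adapted_frame w S b E' F'.
Proof.
move=> [Q [QTQ _ aQ]] [EE FF EF SE SF]; exists (E *m Q), (F *m Q).
have tr (X Y : 'M_(n, k)) :
    (X *m Q)^T *m w *m (Y *m Q) = Q^T *m (X^T *m w *m Y) *m Q.
  by rewrite trmx_mul !mulmxA.
split; rewrite ?tr ?EE ?FF ?EF ?mulmx0 ?mul0mx ?mulmx1 //.
  by rewrite mulmxA SE -!mulmxA aQ.
by rewrite mulmxA SF -!mulmxA aQ.
Qed.

Lemma adapted_frame_sum n k l (w S : 'M[int]_n) (a : 'M[int]_k)
    (b : 'M[int]_l) E F e f :
  w^T = - w ->
  adapted_frame w S a E F -> adapted_frame w S b e f ->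
  E^T *m w *m e = 0 -> E^T *m w *m f = 0 ->
  F^T *m w *m e = 0 -> F^T *m w *m f = 0 ->
  adapted_frame w S (direct_sum a b) (row_mx E e) (row_mx F f).
Proof.
move=> wT [EE FF EF SE SF] [ee ff ef Se Sf] Ee Ef Fe Ff.
have swap0 k1 k2 (X : 'M_(n, k1)) (Y : 'M_(n, k2)) :
    X^T *m w *m Y = 0 -> Y^T *m w *m X = 0.
  by move=> XY; apply: oppr_inj; rewrite -(skew_swap X Y wT) XY trmx0 oppr0.
have gram (X Y : 'M_(n, k)) (x y : 'M_(n, l)) :
    (row_mx X x)^T *m w *m row_mx Y y =
    block_mx (X^T *m w *m Y) (X^T *m w *m y) (x^T *m w *m Y) (x^T *m w *m y).
  by rewrite tr_row_mx mul_col_mx mul_col_row.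
have block0 : block_mx 0 0 0 0 = 0 :> 'M[int]_(k + l, k + l) by exact: block_mx0.
split; rewrite ?gram.
- by rewrite EE ee Ee (swap0 _ _ _ _ Ee) block0.
- by rewrite FF ff Ff (swap0 _ _ _ _ Ff) block0.
- by rewrite EF ef Ef (swap0 _ _ _ _ Fe) -scalar_mx_block.
- by rewrite mul_mx_row SE Se mul_row_block !mulmx0 addr0 add0r.
- by rewrite mul_mx_row SF Sf mul_row_block !mulmx0 addr0 add0r.
Qed.

Lemma residual_orthogonal n k (w S : 'M[int]_n) (a : 'M[int]_k) E F :
  w^T = - w -> adapted_frame w S a E F ->
  E^T *m w *m residual w E F = 0 /\ F^T *m w *m residual w E F = 0.
Proof.
move=> wT Efr; have FE := adapted_frame_unimodular wT Efr.
have [EE FF EF _ _] := Efr; rewrite /residual.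
rewrite !mulmxDr !mulmxN !mulmx1 !(mulmxA (_ *m w)) EE FF EF FE.
by rewrite !mul0mx mulNmx !mul1mx subr0 addr0 !subrr.
Qed.

Lemma residual_idempotent n k (w S : 'M[int]_n) (a : 'M[int]_k) E F :
  w^T = - w -> adapted_frame w S a E F ->
  residual w E F *m residual w E F = residual w E F.
Proof.
move=> wT Efr; have [ER FR] := residual_orthogonal wT Efr.
rewrite {1}/residual !mulmxDl mulNmx mul1mx -!mulmxA.
by rewrite !(mulmxA _ w) ER FR !mulmx0 subr0 addr0.
Qed.

Lemma residual_selfadjoint n k (w : 'M[int]_n) (E F : 'M[int]_(n, k)) :
  w^T = - w -> (residual w E F)^T *m w = w *m residual w E F.
Proof.
move=> wT; rewrite /residual !(raddfD, raddfN) /= !trmx_mul trmx1 !trmxK wT.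
rewrite !(mulmxDl, mulmxDr, mulNmx, mulmxN) mulmx1 mul1mx opprK !mulmxA.
by rewrite addrAC.
Qed.

(** The matrix a of S on E and its matrix on F are transposes of each other by
    duality, so using the same a for both forces a to be symmetric; this is what
    makes the projector onto the span commute with S. *)
Lemma residual_commute n k (w S : 'M[int]_n) (a : 'M[int]_k) E F :
  involutive_isometry w S -> adapted_frame w S a E F ->
  S *m residual w E F = residual w E F *m S.
Proof.
move=> [wT _ STw _] [EE FF EF SE SF].
have a_sym : a^T = a.
  have : (S *m E)^T *m w *m F = E^T *m w *m (S *m F).
    by rewrite trmx_mul -(mulmxA _ _ w) STw !mulmxA.
  by rewrite SE SF trmx_mul mulmxA -!(mulmxA a^T) EF mulmx1 mul1mx.
have wS (X : 'M_(n, k)) : S *m X = X *m a -> X^T *m w *m S = a *m (X^T *m w).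
  by move=> SX; rewrite -mulmxA -STw mulmxA -trmx_mul SX trmx_mul a_sym mulmxA.
rewrite /residual !(mulmxDl, mulmxDr, mulNmx, mulmxN) mulmx1 mul1mx.
by rewrite !mulmxA SE SF -!mulmxA !(mulmxA _ w S) !wS // !mulmxA.
Qed.

(** * Primitive and dual vectors *)

(** In the Smith normal form L D R of a column, D vanishes outside its first
    entry: the primitive vector is the first column of L, and the first row of
    the inverse of L detects it. *)
Lemma primitive_part n (x : 'cV[int]_n) :
  x != 0 ->
  exists c (x0 : 'cV[int]_n) (r : 'rV[int]_n), x = c *: x0 /\ r *m x0 = 1%:M.
Proof.
case: n x => [|n] x; first by rewrite [x]flatmx0 eqxx.
move=> _; have [L Lu [R Ru [d _ ->]]] := int_Smith_normal_form x.
exists (d`_0 * R 0 0), (col 0 L), (row 0 (invmx L)); split.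
  apply/colP=> i; rewrite [R]mx11_scalar mul_mx_scalar !mxE.
  rewrite (bigD1 0) //= !mxE big1 ?addr0 => [|j j0].
    by rewrite eqxx !mulr1n mulrCA mulrC (mulrC (R 0 0)).
  by rewrite !mxE (negPf (_ : j != 0 :> nat)) ?mulr0n ?mulr0.
rewrite -row_mul colE mulmxA mulVmx // mul1mx.
by apply/matrixP=> i j; rewrite !ord1 !mxE eqxx.
Qed.

(** Linear conditions satisfied by a vector pass to its primitive part. *)
Lemma scale_cancel n (A B : 'M[int]_n) (c : int) (x : 'cV[int]_n) :
  c != 0 -> A *m (c *: x) = B *m (c *: x) -> A *m x = B *m x.
Proof.
move=> c0 /eqP; rewrite -!scalemxAr -subr_eq0 -scalerBr scalemx_eq0 (negPf c0) /=.
by rewrite subr_eq0 => /eqP.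
Qed.

(** A vector with an odd entry is an odd multiple of its primitive part x0, so
    it differs from x0 by an even multiple of x0. *)
Lemma odd_primitive_part n (x : 'cV[int]_n) i :
  ~~ (2 %| x i 0%R)%Z ->
  exists (h : int) (x0 : 'cV[int]_n) (r : 'rV[int]_n),
    [/\ 1 + 2 * h != 0, x = (1 + 2 * h) *: x0 & r *m x0 = 1%:M].
Proof.
move=> xi; have x0 : x != 0 by apply: contraNneq xi => ->; rewrite mxE dvdz0.
have [c [x0' [r [xE rx]]]] := primitive_part x0.
have cE : c = 1 + 2 * (c %/ 2)%Z.
  have := divz_eq c 2; rewrite mulrC addrC.
  have := modz_ge0 c (isT : (2 != 0 :> int)).
  have := ltz_pmod c (isT : (0 < 2 :> int)).
  case: (c %% 2)%Z => [[|[|k]]|k] //= _ _ cE.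
  by case/negP: xi; rewrite xE mxE cE add0r -mulrA dvdz_mulr.
exists (c %/ 2)%Z, x0', r; rewrite -cE; split=> //.
by apply: contraTneq x0 => c0; rewrite xE c0 scale0r eqxx.
Qed.

Lemma dual_vector n (w : 'M[int]_n) (x : 'cV[int]_n) (r : 'rV[int]_n) :
  w \in unitmx -> r *m x = 1%:M -> exists y : 'cV[int]_n, x^T *m w *m y = 1%:M.
Proof.
move=> wu rx; exists (invmx w *m r^T).
by rewrite mulmxA mulmxK // -trmx_mul rx trmx1.
Qed.

(** What is used of the residual of a frame when looking for a cell inside the
    orthogonal complement. *)
Record invariant_projector n (w S R : 'M[int]_n) : Prop := InvariantProjector {
  projector_selfadjoint : R^T *m w = w *m R;
  projector_commute : S *m R = R *m S;
  projector_idempotent : R *m R = R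
}.

(** A dual vector may be projected to the summand that contains x. *)
Lemma projected_dual n k (w R : 'M[int]_n) (x : 'M[int]_(n, k))
    (y : 'cV[int]_n) :
  R^T *m w = w *m R -> R *m x = x -> x^T *m w *m (R *m y) = x^T *m w *m y.
Proof. by move=> Rw Rx; rewrite mulmxA -(mulmxA _ w) -Rw mulmxA -trmx_mul Rx. Qed.

(** * Finding a cell in the complement *)

(** The pair x, S x is primitive when x + S x and x - S x are.  With
    h = w(S x, y1), the vector y1 has the values 1 - h and h on x and S x, and
    y2 - S y2 has the values 1 and -1, so y1 + h (y2 - S y2) has the values
    1 and 0. *)
Lemma dual_of_swapped_pair n (w S : 'M[int]_n) (x y1 y2 : 'cV[int]_n) :
  involutive_isometry w S ->
  (x + S *m x)^T *m w *m y1 = 1%:M -> (x - S *m x)^T *m w *m y2 = 1%:M ->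
  exists y : 'cV[int]_n, x^T *m w *m y = 1%:M /\ (S *m x)^T *m w *m y = 0.
Proof.
move=> [wT _ STw SS] ux vx; pose h := (S *m x)^T *m w *m y1.
have adj (z : 'cV_n) : z^T *m w *m (S *m y2) = (S *m z)^T *m w *m y2.
  by rewrite mulmxA -(mulmxA _ w) -STw mulmxA -trmx_mul.
exists (y1 + (y2 - S *m y2) *m h).
move: ux vx; rewrite !raddfB !raddfD /= !mulmxBl !mulmxDl -/h => ux vx.
rewrite !mulmxDr -/h !mulmxN !(mulmxA _ _ h) !adj (mulmxA S S) SS mul1mx.
rewrite -!(mulmxBl _ _ h) vx mul1mx ux; split=> //.
by rewrite -opprB vx mulNmx mul1mx subrr.
Qed.

(** If x + S x = (1 + 2h) u0 and x - S x = (1 + 2h') v0 with u0, v0 primitive,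
    then u0 is S-invariant and v0 is S-anti-invariant, so that replacing x by
    x - h u0 - h' v0 changes x + S x into u0 and x - S x into v0. *)
Lemma swap_cell_exists n (w S R : 'M[int]_n) (x : 'cV[int]_n) i :
  involutive_isometry w S -> invariant_projector w S R ->
  R *m x = x -> ~~ (2 %| (x + S *m x)%R i 0%R)%Z ->
  exists e f : 'M[int]_(n, 2),
    [/\ adapted_frame w S Q0 e f, R *m e = e & R *m f = f].
Proof.
move=> wS wR Rx xi; have [wT wu STw SS] := wS; have [Rw SR RR] := wR.
have [h [u0 [r [h0 uE ru]]]] := odd_primitive_part xi.
have vi : ~~ (2 %| (x - S *m x)%R i 0%R)%Z.
  apply: contra xi => vi.
  have -> : (x + S *m x) i 0 = (x - S *m x) i 0 + 2 * (S *m x) i 0.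
    by rewrite mxE [in RHS]mxE [X in _ = _ + X + _]mxE mulr_natl mulr2n addrA subrK.
  by rewrite rpredD // dvdz_mulr.
have [h' [v0 [r' [h'0 vE rv]]]] := odd_primitive_part vi.
have Su : S *m u0 = u0.
  rewrite -[RHS]mul1mx; apply: scale_cancel h0 _.
  by rewrite -uE mul1mx mulmxDr mulmxA SS mul1mx addrC.
have Sv : S *m v0 = - v0.
  rewrite -[v0 in RHS]mul1mx -mulNmx; apply: scale_cancel h'0 _.
  by rewrite -vE mulNmx mul1mx mulmxBr mulmxA SS mul1mx opprB.
have RSx : R *m (S *m x) = S *m x by rewrite mulmxA -SR -mulmxA Rx.
have Ru : R *m u0 = u0.
  rewrite -[RHS]mul1mx; apply: scale_cancel h0 _.
  by rewrite -uE mul1mx mulmxDr Rx RSx.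
have Rv : R *m v0 = v0.
  rewrite -[RHS]mul1mx; apply: scale_cancel h'0 _.
  by rewrite -vE mul1mx mulmxBr Rx RSx.
pose z := x - h *: u0 - h' *: v0.
have Sz : S *m z = S *m x - h *: u0 + h' *: v0.
  by rewrite !mulmxBr -!scalemxAr Su Sv scalerN opprK.
have double (a : int) (y : 'cV_n) :
    (1 + 2 * a) *: y + (- (a *: y) - a *: y) = y.
  by rewrite mulr_natl mulr2n !scalerDl scale1r -opprD addrK.
have zu : z + S *m z = u0.
  by rewrite Sz addrACA addNr addr0 addrACA uE double.
have zv : z - S *m z = v0.
  by rewrite Sz opprD opprB addrACA (addrA (x - _)) subrK vE double.
have Rz : R *m z = z by rewrite !mulmxBr -!scalemxAr Rx Ru Rv.
have [y1 uy1] := dual_vector wu ru; have [y2 vy2] := dual_vector wu rv.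
rewrite -zu in uy1; rewrite -zv in vy2.
have [y [zy Szy]] := dual_of_swapped_pair wS uy1 vy2.
have RSz : R *m (S *m z) = S *m z by rewrite mulmxA -SR -mulmxA Rz.
(* The form w(., S .) is skew because S is self-adjoint, hence alternating;
   this is why x and S x are orthogonal. *)
have SwT : (w *m S)^T = - (w *m S) by rewrite trmx_mul wT mulmxN STw.
have self0 (a : 'cV_n) : a^T *m w *m (S *m a) = 0.
  by rewrite mulmxA -(mulmxA _ w); exact: skew_self.
have adj (a b : 'cV_n) : (S *m a)^T *m w *m b = a^T *m w *m (S *m b).
  by rewrite trmx_mul -(mulmxA _ _ w) STw !mulmxA.
have SSa (a : 'cV_n) : S *m (S *m a) = a by rewrite mulmxA SS mul1mx.
pose q := R *m y.
have zq : z^T *m w *m q = 1%:M by rewrite projected_dual.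
have Szq : (S *m z)^T *m w *m q = 0 by rewrite projected_dual.
have swapE (a : 'cV_n) : S *m row_mx a (S *m a) = row_mx a (S *m a) *m Q0.
  by rewrite mul_mx_row SSa (mul_row_block a _ 0 1%:M 1%:M 0) !mulmx0 !mulmx1 add0r addr0.
have fixedE (a : 'cV_n) :
    R *m a = a -> R *m row_mx a (S *m a) = row_mx a (S *m a).
  by move=> Ra; rewrite mul_mx_row mulmxA -SR -mulmxA Ra.
exists (row_mx z (S *m z)), (row_mx q (S *m q)); split.
- have gram (a b : 'cV_n) : (row_mx a (S *m a))^T *m w *m row_mx b (S *m b) =
    block_mx (a^T *m w *m b) ((S *m a)^T *m w *m b)
             ((S *m a)^T *m w *m b) (a^T *m w *m b).
    by rewrite tr_row_mx mul_col_mx mul_col_row [in RHS]adj !adj SSa.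
  split; rewrite ?gram ?adj ?self0 ?skew_self // -?adj ?zq ?Szq.
  + exact: (@block_mx0 _ 1 1 1 1).
  + exact: (@block_mx0 _ 1 1 1 1).
  + by rewrite -(@scalar_mx_block _ 1 1).
- exact: fixedE.
- by apply: fixedE; rewrite mulmxA RR.
Qed.

(** The image of N is an orthogonal summand on which S is the scalar b, so any
    primitive vector of it and any dual vector of that one, projected by N,
    form a cell. *)
Lemma sign_cell_exists n (w S R N : 'M[int]_n) (b : 'M[int]_1) :
  involutive_isometry w S ->
  N^T *m w = w *m N -> N *m N = N -> R *m N = N -> N != 0 ->
  (forall x : 'cV_n, S *m (N *m x) = N *m x *m b) ->
  exists e f : 'M[int]_(n, 1),
    [/\ adapted_frame w S b e f, R *m e = e & R *m f = f].
Proof.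
move=> [wT wu _ _] Nw NN RN N0 SN.
have [i Ni] : exists i, col i N != 0.
  apply/existsP; apply: contraNT N0; rewrite negb_exists => /forallP N0.
  apply/eqP/matrixP=> j i; have := N0 i; rewrite negbK => /eqP/colP/(_ j).
  by rewrite !mxE.
have [c [x [r [xE rx]]]] := primitive_part Ni.
have c0 : c != 0 by apply: contraTneq Ni => c0; rewrite xE c0 scale0r eqxx.
have Nx : N *m x = x.
  rewrite -[RHS]mul1mx; apply: scale_cancel c0 _.
  by rewrite -xE mul1mx colE mulmxA NN.
have [y xy] := dual_vector wu rx.
exists x, (N *m y); split.
- split; rewrite ?skew_self ?(projected_dual _ Nw Nx) //.
  by rewrite -{1}Nx SN Nx.
- by rewrite -Nx mulmxA RN.
- by rewrite mulmxA RN.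
Qed.

(** The matrix (1 + S) R decides the type of the cell.  If it is not divisible
    by 2, a column of R spans a swapped pair after correction; if it is, then
    half of it is the projector M onto the S-invariant part of the image of R.
    When M = 0, S acts by -1 on the whole image of R. *)
Lemma involution_cell_exists n (w S R : 'M[int]_n) :
  involutive_isometry w S -> invariant_projector w S R -> R != 0 ->
  exists l (b : 'M[int]_l.+1) (e f : 'M[int]_(n, l.+1)),
    [/\ involution_cell b, adapted_frame w S b e f, R *m e = e & R *m f = f].
Proof.
move=> wS wR R0; have [wT wu STw SS] := wS; have [Rw SR RR] := wR.
pose X := R + S *m R.
case: (boolP [forall i, forall j, (2 %| X i j)%Z]) => [X2|]; last first.
  rewrite negb_forall => /existsP[i]; rewrite negb_forall => /existsP[j Xij].
  have Rj : R *m col j R = col j R by rewrite colE mulmxA RR.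
  have Xj : ~~ (2 %| (col j R + S *m col j R)%R i 0%R)%Z.
    by rewrite !colE mulmxA -mulmxDl -colE mxE.
  have [e [f [efr Re Rf]]] := swap_cell_exists wS wR Rj Xj.
  by exists 1%N, Q0, e, f; split=> //; exact: SwapCell.
pose M := map_mx (fun a => (a %/ 2)%Z) X.
have XM : X = 2%:Z *: M.
  apply/matrixP=> i j; rewrite [RHS]mxE [M i j]mxE mulrC divzK //.
  by have /forallP/(_ i)/forallP/(_ j) := X2.
have two0 : 2%:Z != 0 by [].
have cancel2 (A B : 'M[int]_n) : 2%:Z *: A = 2%:Z *: B -> A = B.
  move/eqP; rewrite -subr_eq0 -scalerBr scalemx_eq0 (negPf two0) /= subr_eq0.
  by move/eqP.
have RX : R *m X = X by rewrite mulmxDr mulmxA -SR -mulmxA RR.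
have SX : S *m X = X by rewrite mulmxDr mulmxA SS mul1mx addrC.
have XX : X *m X = 2%:Z *: X.
  rewrite {1}/X mulmxDl -mulmxA RX SX.
  by rewrite (_ : 2%:Z = 1 + 1) // scalerDl scale1r.
have Xw : X^T *m w = w *m X.
  rewrite /X raddfD /= trmx_mul mulmxDl mulmxDr Rw -(mulmxA _ _ w) STw.
  by rewrite (mulmxA _ w) Rw -!mulmxA SR.
(* X = R + S R satisfies X^2 = 2 X, which becomes M^2 = M. *)
have [M0|M0] := eqVneq M 0.
  have SRN : S *m R = - R.
    by apply/eqP; rewrite -addr_eq0 addrC -/X XM M0 scaler0.
  have [|e [f [efr Re Rf]]] :=
    sign_cell_exists (b := - 1%:M) wS Rw RR RR R0.
    by move=> x; rewrite mulmxA SRN mulNmx mulmxN mulmx1.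
  by exists 0%N, (- 1%:M), e, f; split=> //; exact: MinusCell.
have RM : R *m M = M by apply: cancel2; rewrite scalemxAr -XM.
have SM : S *m M = M by apply: cancel2; rewrite scalemxAr -XM.
have MM : M *m M = M.
  by apply/cancel2/cancel2; rewrite scalemxAl scalemxAr -XM XX.
have Mw : M^T *m w = w *m M.
  by apply: cancel2; rewrite scalemxAl scalemxAr -linearZ /= -XM.
have [|e [f [efr Re Rf]]] := sign_cell_exists (b := 1%:M) wS Mw MM RM M0.
  by move=> x; rewrite mulmxA SM mulmx1.
by exists 0%N, 1%:M, e, f; split=> //; exact: PlusCell.
Qed.

(** * Growing a frame to a symplectic basis *)

Lemma total_frame_exists n (w S : 'M[int]_n) :
  involutive_isometry w S ->
  exists p m t (E F : 'M[int]_(n, p + m + 2 * t)),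
    adapted_frame w S (amx p m t) E F /\ residual w E F = 0.
Proof.
move=> wS; have [wT _ _ _] := wS.
(* The induction is on the excess of n + 1 over the size k of the frame; it
   never reaches zero as k <= n. *)
suff grow d p m t (E F : 'M[int]_(n, p + m + 2 * t)) :
    (n < p + m + 2 * t + d)%N -> adapted_frame w S (amx p m t) E F ->
    exists p m t (E F : 'M[int]_(n, p + m + 2 * t)),
      adapted_frame w S (amx p m t) E F /\ residual w E F = 0.
  apply: (grow n.+1 0%N 0%N 0%N 0 0); first exact: ltnSn.
  by split; apply/matrixP=> i [].
elim: d p m t E F => [|d IHd] p m t E F lt_d Efr.
  have := leq_trans (leq_addr _ _) (adapted_frame_size wT Efr).
  by rewrite leqNgt -[(p + m + _)%N]addn0 lt_d.
have [R0|R0] := eqVneq (residual w E F) 0; first by exists p, m, t, E, F.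
have wR : invariant_projector w S (residual w E F).
  split; first exact: residual_selfadjoint.
    exact: residual_commute wS Efr.
  exact: residual_idempotent wT Efr.
have [l [b [e [f [bcell efr Re Rf]]]]] := involution_cell_exists wS wR R0.
have [ER FR] := residual_orthogonal wT Efr.
have orth h (X : 'M_(n, h)) (y : 'M_(n, l.+1)) :
    X^T *m w *m residual w E F = 0 -> residual w E F *m y = y ->
    X^T *m w *m y = 0.
  by move=> XR <-; rewrite mulmxA XR mul0mx.
have Eefr : adapted_frame w S (direct_sum (amx p m t) b)
              (row_mx E e) (row_mx F f).
  by apply: adapted_frame_sum => //; exact: orth.
have [p' [m' [t' ab]]] := amx_sum_cell p m t bcell.
have [E' [F' Efr']] := adapted_frame_similar ab Eefr.
apply: IHd Efr'; rewrite -(orthogonally_similar_size ab).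
by apply: leq_trans lt_d _; rewrite addnS -addSn leq_add2r addnS ltnS leq_addr.
Qed.

Theorem theorem1 (g : nat) (S : 'M[int]_(g + g))
    (S_symp : Sp S) (S_invol : S *m S = 1%:M) :
  exists (p m t : nat) (eg : (p + m + 2 * t)%N = g),
    let a : 'M[int]_g := castmx (eg, eg) (amx p m t) in
    symplectically_equivalent S (block_mx a 0 0 a).
Proof.
have [_ SJS] := S_symp.
have JT : (Jmx g)^T = - Jmx g.
  by rewrite tr_block_mx opp_block_mx raddfN /= !trmx0 !trmx1 !oppr0 opprK.
have JJ : Jmx g *m - Jmx g = 1%:M.
  rewrite mulmxN mulmx_block !mulmx0 !mul0mx !mulmxN !mulNmx !mul1mx !addr0 !add0r.
  by rewrite opp_block_mx !oppr0 !opprK -scalar_mx_block.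
have wS : involutive_isometry (Jmx g) S.
  split=> //; first by have [] := mulmx1_unit JJ.
  by rewrite -[LHS]mulmx1 -S_invol mulmxA SJS.
have [p [m [t [E [F [Efr R0]]]]]] := total_frame_exists wS.
pose P := row_mx E F; pose Q := col_mx (- (F^T *m Jmx g)) (E^T *m Jmx g).
have PQ : P *m Q = 1%:M.
  rewrite mul_row_col mulmxN addrC; apply/eqP.
  by rewrite eq_sym -subr_eq0 opprB addrCA addrC; exact/eqP.
have eg : (p + m + 2 * t)%N = g.
  apply/eqP; rewrite -(inj_eq double_inj) -!addnn eqn_leq (mulmx1_min PQ) andbT.
  exact: adapted_frame_size Efr.
exists p, m, t, eg; subst g; rewrite castmx_id /=.
have FE := adapted_frame_unimodular JT Efr; have [EE FF EF SE SF] := Efr.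
(* The columns of P are the symplectic basis, so S P = P (a + a) with a + a
   block diagonal; the conjugating matrix is therefore the inverse of P. *)
have [Pu _] := mulmx1_unit PQ.
have PJP : P^T *m Jmx _ *m P = Jmx _.
  by rewrite tr_row_mx mul_col_mx mul_col_row EE FF EF FE.
exists (invmx P); split; first split; rewrite ?unitmx_inv //.
  by rewrite -[in LHS]PJP trmx_inv !mulmxA mulVmx ?unitmx_tr // mul1mx mulmxK.
rewrite invmxK -mulmxA mul_mx_row SE SF.
have -> : row_mx (E *m amx p m t) (F *m amx p m t) =
          P *m block_mx (amx p m t) 0 0 (amx p m t).
  by rewrite mul_row_block !mulmx0 addr0 add0r.
by rewrite mulKmx.
Qed.
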